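(* Let $E=(E^0,E^1,r,s)$ be a $P$-simple graph. Suppose that $Z:=r(E^1)\cup s(E^1)$ is connected in $E$ and that there exists $n\in\mathbb N$ such that the graph $\mathcal E_n$ exists and has finitely many vertices. Let $\varphi:C^*(E)\to B(H)$ be a representation on a Hilbert space $H$, and put $H_v=\varphi(P_v)(H)$ for $v\in E^0$ and $H_e=\varphi(S_e)\varphi(S_e)^*(H)$ for $e\in E^1$. Then for all $v\in E^0$ and all $e\in E^1$ there exist total orthonormal sets $B_v$ and $B_e$ of $H_v$ and $H_e$, respectively, such that for all $v\in E^0$ and $e\in E^1$: 1. if $e\in s^{-1}(v)$ then $B_e\subseteq B_v$, and if $0<\#s^{-1}(v)<\infty$ then $B_v=\bigcup_{e\in s^{-1}(v)}B_e$; 2. if $e\in r^{-1}(v)$ then $\varphi(S_e)(B_v)=B_e$.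
   Context: A graph $E=(E^0,E^1,r,s)$ consists of arbitrary sets $E^0$ (vertices) and $E^1$ (edges) and maps $r,s:E^1\to E^0$ (range and source). $C^*(E)$ is the universal $C^*$-algebra generated by mutually orthogonal projections $\{P_v\}_{v\in E^0}$ and partial isometries $\{S_e\}_{e\in E^1}$ with orthogonal ranges such that $S_e^*S_e=P_{r(e)}$ and $P_{s(e)}S_eS_e^*=S_eS_e^*$ for all $e\in E^1$, and $P_v=\sum_{e\in s^{-1}(v)}S_eS_e^*$ for every $v$ with $0<\#s^{-1}(v)<\infty$. A representation of $C^*(E)$ is a $*$-homomorphism into $B(H)$. A total orthonormal set of a Hilbert space is an orthonormal set with dense span. An (undirected) path between $u,v\in E^0$ is a pair $(u_0u_1\ldots u_n,e_1\ldots e_n)$ with $u_i\in E^0$, $e_i\in E^1$, $u_0=u$, $u_n=v$, $e_i\neq e_j$ for $i\neq j$, and for each $i=1,\ldots,n$ either $r(e_i)=u_{i-1}$ and $s(e_i)=u_i$, or $r(e_i)=u_i$ and $s(e_i)=u_{i-1}$. $E$ is $P$-simple if $E$ has no loops (no edges with $r(e)=s(e)$) and for all $u\neq v$ in $r(E^1)\cup s(E^1)$ there is at most one path between $u$ and $v$. A set $V\subseteq E^0$ is connected in $E$ if for all $u,v\in V$ there is a path in $E$ between $u$ and $v$ (for $u=v$ the trivial path with $n=0$ is allowed). An extreme vertex of $E$ is a vertex $v$ with $\#(s^{-1}(v)\cup r^{-1}(v))=1$ that is not the base of a loop; the unique edge adjacent to it (having $v$ as source or range) is called an extreme edge. Put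 $\mathcal E_0=E$. If $\mathcal E_{i-1}$ exists ($i\ge1$), let $X_i$ and $Y_i$ be the sets of extreme vertices and extreme edges of $\mathcal E_{i-1}$; if these are non-empty, $\mathcal E_i$ exists and is the subgraph $(E^0\setminus(X_1\cup\cdots\cup X_i),\,E^1\setminus(Y_1\cup\cdots\cup Y_i),\,r_i,\,s_i)$ with $r_i,s_i$ the restrictions of $r,s$; otherwise $\mathcal E_i$ does not exist. Here $\mathbb N=\{1,2,\ldots\}$. *)

(* Defs.v *)
From HB Require Import structures.
From mathcomp Require Import all_boot all_order all_algebra.
From mathcomp Require Import sesquilinear complex.
From mathcomp Require Import boolp classical_sets functions cardinality fsbigop.
From mathcomp Require Import reals topology normedtype.

Set Implicit Arguments.
Unset Strict Implicit.
Unset Printing Implicit Defensive.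

Import Order.TTheory GRing.Theory Num.Theory.
Import numFieldNormedType.Exports.

Local Open Scope classical_set_scope.
Local Open Scope ring_scope.

Record graph := Graph {
  vertex : Type;
  edge : Type;
  range_of : edge -> vertex;
  source_of : edge -> vertex }.

(* [uniq] and finitely supported sums over edges need an eqType and a
   choiceType; both come from classical logic, so [edge E] is arbitrary. *)
HB.instance Definition _ (E : graph) := gen_eqMixin (edge E).
HB.instance Definition _ (E : graph) := gen_choiceMixin (edge E).

Section Graphs.
Variable E : graph.
Implicit Types (u v w : vertex E) (e : edge E).

Definition outgoing v : set (edge E) := @source_of E @^-1` [set v].
Definition incoming v : set (edge E) := @range_of E @^-1` [set v].

Definition non_isolated : set (vertex E) :=
  range (@range_of E) `|` range (@source_of E).

Definition joins e u w : Prop :=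
  (range_of e = u /\ source_of e = w) \/ (range_of e = w /\ source_of e = u).

Fixpoint chain u (us : seq (vertex E)) (es : seq (edge E)) : Prop :=
  match us, es with
  | [::], [::] => True
  | w :: us', e :: es' => joins e u w /\ chain w us' es'
  | _, _ => False
  end.

(* p = (u_0 u_1 ... u_n, e_1 ... e_n); [chain] forces the lengths to match. *)
Definition is_path u v (p : seq (vertex E) * seq (edge E)) : Prop :=
  match p with
  | ([::], _) => False
  | (u0 :: us, es) => [/\ u0 = u, last u0 us = v, uniq es & chain u0 us es]
  end.

Definition P_simple : Prop :=
  (forall e, range_of e <> source_of e) /\
  (forall u v, non_isolated u -> non_isolated v -> u <> v ->
     forall p q, is_path u v p -> is_path u v q -> p = q).

Definition connected_in (V : set (vertex E)) : Prop :=
  forall u v, V u -> V v -> exists p, is_path u v p.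

(* Subgraphs are given by their vertex and edge sets, with the range and source
   maps of E.  Every [layer] below is closed under taking endpoints of its edges
   since all edges at a removed vertex are removed with it. *)
Record subgraph := Subgraph {
  sub_vertex : set (vertex E);
  sub_edge : set (edge E) }.

Implicit Type G : subgraph.

Definition adjacent_edges G v : set (edge E) :=
  sub_edge G `&` (outgoing v `|` incoming v).

Definition extreme_vertex G : set (vertex E) :=
  [set v | [/\ sub_vertex G v,
               exists e, adjacent_edges G v = [set e] &
               ~ exists e, [/\ sub_edge G e, range_of e = v & source_of e = v]]].

Definition extreme_edge G : set (edge E) :=
  [set e | exists2 v, extreme_vertex G v & adjacent_edges G v e].

Definition prune G : subgraph :=
  Subgraph (sub_vertex G `\` extreme_vertex G) (sub_edge G `\` extreme_edge G).

(* [layer n G]: the n-th graph of the pruning sequence exists and equals G. *)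
Inductive layer : nat -> subgraph -> Prop :=
| layer0 : layer 0 (Subgraph setT setT)
| layerS n G : layer n G -> extreme_vertex G !=set0 -> extreme_edge G !=set0 ->
    layer n.+1 (prune G).

End Graphs.

(* Not necessarily unital and possibly zero. *)
HB.mixin Record isCStarAlgebra (R : realType) A
    of CompleteNormedModule R[i] A := {
  cmul : A -> A -> A;
  cstar : A -> A;
  cmulA : associative cmul;
  cmulDl : left_distributive cmul +%R;
  cmulDr : right_distributive cmul +%R;
  cmulZl : forall (k : R[i]) a b, cmul (k *: a) b = k *: cmul a b;
  cmulZr : forall (k : R[i]) a b, cmul a (k *: b) = k *: cmul a b;
  cstarK : involutive cstar;
  cstarD : forall a b, cstar (a + b) = cstar a + cstar b;
  cstarZ : forall (k : R[i]) a, cstar (k *: a) = Num.conj k *: cstar a;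
  cstarM : forall a b, cstar (cmul a b) = cmul (cstar b) (cstar a);
  norm_cmul_le : forall a b, `|cmul a b| <= `|a| * `|b|;
  norm_cstar_cmul : forall a, `|cmul (cstar a) a| = `|a| ^+ 2 }.

#[short(type="cstarAlgType")]
HB.structure Definition CStarAlgebra (R : realType) :=
  {A of isCStarAlgebra R A & CompleteNormedModule R[i] A}.

Declare Scope cstar_scope.
Delimit Scope cstar_scope with cstar.
Notation "a · b" := (cmul a b) (at level 40, left associativity) : cstar_scope.
Notation "a ^*" := (cstar a) : cstar_scope.
Local Open Scope cstar_scope.

Record star_morphism (R : realType) (A B : cstarAlgType R) := StarMorphism {
  star_morphism_fun :> {linear A -> B};
  star_morphismM : forall a b,
    star_morphism_fun (a · b) = star_morphism_fun a · star_morphism_fun b;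
  star_morphism_star : forall a,
    star_morphism_fun (a ^*) = (star_morphism_fun a) ^* }.

Record closed_star_subalgebra (R : realType) (A : cstarAlgType R) (D : set A) :
    Prop := ClosedStarSubalgebra {
  subalg_closed : closed D;
  subalg0 : D 0;
  subalgD : forall a b, D a -> D b -> D (a + b);
  subalgZ : forall (k : R[i]) a, D a -> D (k *: a);
  subalgM : forall a b, D a -> D b -> D (a · b);
  subalg_star : forall a, D a -> D (a ^*) }.

Record graph_family (R : realType) (E : graph) (A : cstarAlgType R)
    (P : vertex E -> A) (S : edge E -> A) : Prop := GraphFamily {
  family_proj : forall v, P v · P v = P v /\ (P v)^* = P v;
  family_proj_orth : forall v w, v <> w -> P v · P w = 0;
  family_pisom : forall e, S e · (S e)^* · S e = S e;
  family_range_orth : forall e f, e <> f ->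
    (S e · (S e)^*) · (S f · (S f)^*) = 0;
  family_init : forall e, (S e)^* · S e = P (range_of e);
  family_final : forall e, P (source_of e) · (S e · (S e)^*) = S e · (S e)^*;
  family_sum : forall v, outgoing v !=set0 -> finite_set (outgoing v) ->
    P v = \sum_(e \in outgoing v) (S e · (S e)^*) }.

(* C*(E) is specified by its universal property; [universal] gives existence of
   the induced morphism and [generated] its uniqueness. *)
Record is_graph_algebra (R : realType) (E : graph) (A : cstarAlgType R)
    (P : vertex E -> A) (S : edge E -> A) : Prop := IsGraphAlgebra {
  graph_algebra_family : graph_family P S;
  graph_algebra_generated : forall D : set A, closed_star_subalgebra D ->
    (forall v, D (P v)) -> (forall e, D (S e)) -> D = setT;
  graph_algebra_universal : forall (B : cstarAlgType R)
      (Q : vertex E -> B) (T : edge E -> B), graph_family Q T ->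
    exists f : star_morphism A B,
      (forall v, f (P v) = Q v) /\ (forall e, f (S e) = T e) }.

(* The inner product is linear in its first argument. *)
Record hilbertType (R : realType) := Hilbert {
  hilbert_space :> completeNormedModType R[i];
  dotH : {dot hilbert_space for Num.conj};
  dotH_norm : forall x, `|x| ^+ 2 = dotH x x }.

Arguments dotH {R h}.

Record bounded_operator (R : realType) (H : hilbertType R) := BoundedOperator {
  bounded_operator_fun :> {linear H -> H};
  bounded_operator_continuous : continuous bounded_operator_fun }.

Section Hilbert.
Variables (R : realType) (H : hilbertType R).

Definition is_adjoint (T T' : H -> H) : Prop :=
  forall x y, dotH (T x) y = dotH x (T' y).

(* The default 0 is never used for a bounded T, by Riesz representation. *)
Definition adjoint (T : bounded_operator H) : H -> H :=
  xget (fun=> 0) [set T' | is_adjoint T T'].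

Definition orthonormal_set (B : set H) : Prop :=
  (forall x, B x -> dotH x x = 1) /\
  (forall x y, B x -> B y -> x <> y -> dotH x y = 0).

Definition linear_span (B : set H) : set H :=
  [set x | exists (n : nat) (c : 'I_n -> R[i]) (b : 'I_n -> H),
     (forall i, B (b i)) /\ x = \sum_(i < n) c i *: b i].

Definition total_orthonormal_set (V B : set H) : Prop :=
  [/\ B `<=` V, orthonormal_set B & V `<=` closure (linear_span B)].

End Hilbert.

Record representation (R : realType) (A : cstarAlgType R) (H : hilbertType R) :=
  Representation {
  rep_fun :> A -> bounded_operator H;
  rep_linear : forall (k : R[i]) a b (x : H),
    rep_fun (k *: a + b) x = k *: rep_fun a x + rep_fun b x;
  repM : forall a b (x : H), rep_fun (a · b) x = rep_fun a (rep_fun b x);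
  rep_star : forall a, is_adjoint (rep_fun a) (rep_fun (a ^*)) }.

(* Main.v *)
Require Import Defs.
From HB Require Import structures.
From mathcomp Require Import all_boot all_order all_algebra.
From mathcomp Require Import sesquilinear complex.
From mathcomp Require Import boolp classical_sets functions cardinality fsbigop.
From mathcomp Require Import reals topology normedtype.
From mathcomp Require Import ring lra zify.

(** The point is that the bases can be written down once the graph has no
    infinite forward path [v_0 -> v_1 -> v_2 -> ...], each edge [e] being read
    as an arrow from [source_of e] to [range_of e].

    Write [H_v] for the range of [phi (P v)].  The operator [phi (S e)] maps
    [H_(range_of e)] isometrically onto [H_e], a subspace of [H_(source_of e)], and the [H_e]
    for distinct [e] are orthogonal.  So a basis of [H_v] is obtained by
    transporting the bases of the spaces [H_(range_of e)], [e] leaving [v], and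
    completing with a basis of the part of [H_v] orthogonal to every [H_e], here
    called [defect_space].  Taking this recipe as an inductive definition
    ([basis]) makes both compatibility conditions hold by construction: the
    basis of [H_e] is by definition the image of that of [H_(range_of e)], and
    when finitely many edges (at least one) leave [v] the relation
    [P v = \sum_e S e · (S e)^*] annihilates the defect space
    ([defect_space_eq0]), so that nothing is added to the transported vectors.

    Orthonormality is an induction on derivations ([basis_orthonormal]).
    Totality is where infinite paths matter: a vector [x] of [H_v] orthogonal to
    [basis v] gives vectors [phi (S e)^* x] of [H_(range_of e)] orthogonal to
    [basis (range_of e)]; if forward paths are well-founded these vanish by
    induction, so [x] lies in the defect space and vanishes too ([basis_total]).
    Passing from no nonzero orthogonal vector to a dense span is the projection
    theorem in a complete space ([projection], [dense_span]).

    Well-foundedness ([successor_wf]) comes from the pruning hypothesis.  On an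
    infinite forward path the vertices are distinct, as a repetition would close
    a cycle and give two paths between neighbouring vertices.  Every vertex
    beyond the first then has two adjacent edges on the path, so each pruning
    step removes at most the first path vertex that is left; every layer keeps
    infinitely many vertices, against finiteness of one of them. *)

Set Implicit Arguments.
Unset Strict Implicit.
Unset Printing Implicit Defensive.

Import Order.TTheory GRing.Theory Num.Theory.
Import numFieldNormedType.Exports.

Local Open Scope classical_set_scope.
Local Open Scope ring_scope.

(** * Forward paths in the graph *)

Section ForwardPaths.
Context {E : graph}.
Implicit Types (u v w : vertex E) (e : edge E) (a : nat -> vertex E) (f : nat -> edge E).

Definition forward_ray a f : Prop :=
  forall i, source_of (f i) = a i /\ range_of (f i) = a i.+1.

Lemma ray_chain a f i n : forward_ray a f ->
  chain (a i) [seq a j | j <- iota i.+1 n] [seq f j | j <- iota i n].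
Proof.
move=> ray; elim: n i => //= n IH i; split; last exact: IH.
by right; case: (ray i).
Qed.

(** A repetition closes a cycle; cutting out one edge of a shortest one leaves a
    second path between the ends of that edge. *)
Lemma forward_ray_injective a f : P_simple E -> forward_ray a f -> injective a.
Proof.
move=> [noloop uniqp] ray.
have key n i : a i <> a (i + n.+1)%N.
  elim/ltn_ind: n i => n IH i aa.
  have [m nE] : exists m, n = m.+1.
    case: n aa {IH} => [|m] aa; last by exists m.
    by case: (noloop (f i)); have [-> ->] := ray i; rewrite aa addn1.
  have inj j k : (i <= j)%N -> (j < k)%N -> (k < i + n.+1)%N -> a j <> a k.
    move=> ij jk kn.
    have := IH (k - j).-1 ltac:(lia) j.
    by have -> : (j + (k - j).-1.+1 = k)%N by lia.
  (* The edge [f i] traversed backwards, and the rest of the cycle. *)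
  have u1 : is_path (a i.+1) (a i) ([:: a i.+1; a i], [:: f i]).
    by split=> //=; split=> //; left; have [-> ->] := ray i.
  have u2 : is_path (a i.+1) (a i)
      (a i.+1 :: [seq a j | j <- iota i.+2 n], [seq f j | j <- iota i.+1 n]).
    split=> //.
    - rewrite (last_map a) [a i]aa; congr a.
      by rewrite nE -(addn1 m) iotaD last_cat /=; lia.
    - have fI (j k : nat) : (i < j < i.+1 + n)%N -> (i < k < i.+1 + n)%N ->
          f j = f k -> j = k.
        move=> ij ik fjk.
        have ajk : a j = a k.
          by have [<- _] := ray j; have [<- _] := ray k; rewrite fjk.
        have [jk|kj|//] := ssrnat.ltngtP j k.
          by case: (inj j k) => //; lia.
        by case: (inj k j) => //; lia.
      rewrite map_inj_in_uniq ?iota_uniq// => j k; rewrite !mem_iota; exact: fI.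
    - exact: ray_chain.
  have ne : a i.+1 <> a i.
    by have [<- <-] := ray i; exact: noloop.
  have nz j : non_isolated (a j).
    by right; exists (f j) => //; case: (ray j).
  have := uniqp _ _ (nz _) (nz _) ne _ _ u1 u2.
  rewrite nE/= => -[_ _ fE _].
  apply: (inj i i.+1) => //; first by lia.
  by have [<- _] := ray i; have [<- _] := ray i.+1; rewrite fE.
move=> j k ajk; have [jk|kj|//] := ssrnat.ltngtP j k.
  case: (key (k - j).-1 j); rewrite ajk; congr a; lia.
case: (key (j - k).-1 k); rewrite -ajk; congr a; lia.
Qed.

(** A vertex of the ray other than the first remaining one still has both of its
    neighbouring edges on the ray, hence is not extreme: a pruning step moves the
    start of the surviving tail by at most one. *)
Lemma layer_ray_tail a f n G : forward_ray a f -> injective a -> layer n G ->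
  forall i, (n <= i)%N -> sub_vertex G (a i) /\ sub_edge G (f i).
Proof.
move=> ray inj; elim=> {n G} [//|n G _ IH _ _ i ni].
have nextreme j : (n < j)%N -> ~ extreme_vertex G (a j).
  move=> nj [_ [e eE] _].
  have e1 : f j = e.
    suff : adjacent_edges G (a j) (f j) by rewrite eE.
    by split; [case: (IH j (ltnW nj))|left; case: (ray j)].
  have e2 : f j.-1 = e.
    suff : adjacent_edges G (a j) (f j.-1) by rewrite eE.
    split; first by case: (IH j.-1 ltac:(lia)).
    by right; case: (ray j.-1) => _; rewrite prednK//; lia.
  have : a j = a j.-1.
    by have [<- _] := ray j; have [<- _] := ray j.-1; rewrite e1 e2.
  by move/inj; lia.
have [vi ei] := IH i (ltnW ni); split; split=> //; first exact: nextreme.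
have [sfi rfi] := ray i; move=> [v vx [_ [vE|vE]]].
  by apply: (nextreme i) => //; rewrite -sfi vE.
by apply: (nextreme i.+1); [lia|rewrite -rfi vE].
Qed.

Lemma no_forward_ray a f n (G : subgraph E) : P_simple E -> layer n G ->
  finite_set (sub_vertex G) -> ~ forward_ray a f.
Proof.
move=> simE lay finG ray; have inj := forward_ray_injective simE ray.
have : infinite_set [set: nat] by exact: infinite_nat.
apply; apply: (@sub_finite_set _ _ ((fun i => a (n + i)%N) @^-1` sub_vertex G)).
  by move=> i _ /=; case: (layer_ray_tail ray inj lay (leq_addr i n)).
apply: finite_preimage => // i j _ _ /inj; lia.
Qed.

Definition successor u v : Prop :=
  exists2 e, source_of e = v & range_of e = u.

Lemma successor_wf n (G : subgraph E) : P_simple E -> layer n G ->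
  finite_set (sub_vertex G) -> well_founded successor.
Proof.
move=> simE lay finG v.
apply: contrapT => nAv.
have step (x : {u | ~ Acc successor u}) :
    exists e, source_of e = sval x /\ ~ Acc successor (range_of e).
  case: x => u /= nAu; apply: contrapT => none; apply: nAu.
  constructor=> w [e es er]; apply: contrapT => nAw; apply: none.
  by exists e; rewrite er.
have [g gP] := choice step.
pose next x : {u | ~ Acc successor u} := exist _ (range_of (g x)) (gP x).2.
pose p i := iter i next (exist _ v nAv).
apply: (@no_forward_ray (fun i => sval (p i)) (fun i => g (p i)) n G simE lay finG).
by move=> i; split=> //; case: (gP (p i)).
Qed.
End ForwardPaths.

(** * Projections and orthonormal sets in a Hilbert space *)

Local Notation "a %:C" := (real_complex _ a).

Section Hilbert.
Context {R : realType} {H : hilbertType R}.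
Implicit Types (x y z b u v m l : H) (B V : set H).

(** Minimise over [t] along the line through [z] directed by [b]: if no point of
    the line has squared norm below [d], the slope at [z] is controlled by the
    gap between [d] and the squared norm of [z].  With [d = 0] this is a form of
    the Cauchy-Schwarz inequality; with [d] a squared distance to a subspace it
    says that near-minimisers are nearly orthogonal to the subspace.  The
    summand 1 lets [b = 0] through without a case distinction. *)
Lemma sqr_dotH_le_gap (d : R[i]) z b :
  (forall t : R[i], d <= dotH (z - t *: b) (z - t *: b)) ->
  `|dotH z b| ^+ 2 <= (dotH z z - d) * (dotH b b + 1).
Proof.
move=> dP; set a := dotH z b; set be := dotH b b.
have be0 : 0 <= be by rewrite dnorm_ge0.
have be1 : 0 < be + 1 by rewrite ltr_wpDl.
(* The optimal step is [a / be]; dividing by [be + 1] is good enough. *)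
pose s := (be + 1)^-1.
have s0 : 0 < s by rewrite invr_gt0.
have sR : Num.conj s = s by apply/CrealP/ger0_real/ltW.
have := dP (s * a).
rewrite dnormB dnormZ linearZr_LR/= normrM exprMn (ger0_norm (ltW s0)).
rewrite -/a -/be !rmorphM /= !conjCK sR.
have -> : dotH z z + s ^+ 2 * `|a| ^+ 2 * be
    - (s * Num.conj a * a + s * a * Num.conj a) =
    dotH z z - `|a| ^+ 2 * s ^+ 2 * (be + 1 + 1).
  have sE : s = s ^+ 2 * (be + 1) by rewrite expr2 mulfVK// gt_eqF.
  by rewrite normCK {2 3}sE; ring.
move=> dle.
rewrite -ler_pdivrMr// -/s.
apply: (@le_trans _ _ (`|a| ^+ 2 * s ^+ 2 * (be + 1 + 1))).
  rewrite mulrDr {1}expr2 -!mulrA mulVf ?gt_eqF// !mulr1.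
  by rewrite lerDl mulrA !mulr_ge0// ltW.
by rewrite lerBrDr addrC -lerBrDr.
Qed.

Lemma sqr_dotH_le z b : `|dotH z b| ^+ 2 <= dotH z z * (dotH b b + 1).
Proof.
by have := @sqr_dotH_le_gap 0 z b; rewrite subr0; apply=> t; exact: dnorm_ge0.
Qed.

Lemma parallelogram u v :
  dotH (u - v) (u - v) =
  dotH u u *+ 2 + dotH v v *+ 2 - dotH (2^-1 *: (u + v)) (2^-1 *: (u + v)) *+ 4.
Proof.
rewrite dnormZ dnormB dnormD normfV normr_nat.
by field.
Qed.

Lemma sqr_normD (u v : R[i]) : `|u + v| ^+ 2 <= (`|u| ^+ 2 + `|v| ^+ 2) *+ 2.
Proof.
rewrite -subr_ge0.
have -> : (`|u| ^+ 2 + `|v| ^+ 2) *+ 2 - `|u + v| ^+ 2 = `|u - v| ^+ 2.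
  by rewrite !normCK rmorphD rmorphB/=; ring.
by rewrite exprn_ge0.
Qed.

Lemma gt0_real_complex (e : R[i]) : 0 < e -> (complex.Re e)%:C = e /\ 0 < complex.Re e.
Proof.
move=> e0; have eE : (complex.Re e)%:C = e by apply/RRe_real/gtr0_real.
by split=> //; rewrite -ltcR eE.
Qed.

Section Projection.
Variables (M : set H).
Hypotheses (M0 : M 0) (MZD : forall (k : R[i]) (u v : H), M u -> M v -> M (k *: u + v)).

(** The near-minimisers of the distance from [x] to [M] form a filter base, which
    is Cauchy by the parallelogram law; its limit is the projection of [x]. *)
Lemma projection x :
  exists2 l, closure M l & forall b, M b -> dotH (x - l) b = 0.
Proof.
pose N m := complex.Re (dotH (x - m) (x - m)).
have NE m : (N m)%:C = dotH (x - m) (x - m) by apply/RRe_real/ger0_real/dnorm_ge0.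
have N0 m : 0 <= N m by rewrite -lecR NE dnorm_ge0.
have lbN : has_lbound (N @` M) by exists 0 => _ [m _ <-].
have infN : has_inf (N @` M) by split=> //; exists (N 0), 0.
pose d := inf (N @` M).
have dmin m : M m -> d%:C <= dotH (x - m) (x - m).
  by move=> Mm; rewrite -NE lecR; apply: ge_inf => //; exists m.
pose near_min (e : R) := [set m | M m /\ N m < d + e].
pose F : set_system H := filter_from [set e : R | 0 < e] near_min.
have FF : ProperFilter F.
  apply: filter_from_proper => [|e e0]; last first.
    by have [_ [m Mm <-] Nm] := inf_adherent e0 infN; exists m.
  apply: filter_from_filter; first by exists 1; exact: ltr01.
  move=> e1 e2 e10 e20; exists (Num.min e1 e2); first by rewrite /= lt_min e10.
  move=> m [Mm Nm]; split; split=> //; apply: (lt_le_trans Nm);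
    by rewrite lerD2l ge_min lexx ?orbT.
have FM : F M by exists 1; [exact: ltr01|move=> m []].
have close m m' (e : R) : near_min e m -> near_min e m' ->
    `|m - m'| ^+ 2 <= (e *+ 4)%:C.
  move=> [Mm Nm] [Mm' Nm'].
  have -> : m - m' = (x - m') - (x - m) by rewrite opprB [RHS]addrC addrA subrK.
  rewrite dotH_norm parallelogram.
  have Mh : M (2^-1 *: (m + m')).
    by rewrite -[X in M X]addr0; apply: MZD => //; rewrite -[m]scale1r; exact: MZD.
  have -> : 2^-1 *: (x - m' + (x - m)) = x - 2^-1 *: (m + m').
    rewrite addrACA -opprD scalerBr -mulr2n -(scaler_nat 2 x) scalerA mulVf ?pnatr_eq0//.
    by rewrite scale1r [m' + m]addrC.
  set h := 2^-1 *: _ in Mh *; rewrite -!NE -!rmorphMn -rmorphD -rmorphB lecR.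
  have := dmin _ Mh; rewrite -NE lecR; lra.
have /cauchy_cvg/cvg_ex[l Fl] : cauchy F.
  apply: cauchy_exP => eps /gt0_real_complex[<-]; set r := complex.Re eps => r0.
  have e0 : 0 < r ^+ 2 / 8 by rewrite divr_gt0// exprn_gt0.
  have [_ [m Mm <-] Nm] := inf_adherent e0 infN.
  exists m, (r ^+ 2 / 8) => // m' m'e.
  rewrite -ball_normE /= -ltr_sqr ?nnegrE// ?ler0c ?(ltW r0)//.
  apply: le_lt_trans (close _ _ _ (conj Mm Nm) m'e) _.
  by rewrite -rmorphXn ltcR; have := exprn_gt0 2 r0; lra.
exists l.
  move=> B Bl; have /(@filter_ex _ _ FF)[m []] : F (M `&` B); last by exists m.
  by apply: filterI => //; exact: Fl.
move=> b Mb; set a := dotH (x - l) b.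
apply/eqP/negP => /negP an0.
pose c := dotH b b + 1.
have c1 : 1 <= c by rewrite lerDr dnorm_ge0.
have c0 : 0 < c by rewrite (lt_le_trans ltr01).
(* The radius is chosen so that the final bound contradicts [a != 0]. *)
have q0 : 0 < `|a| / (c *+ 4) by rewrite divr_gt0 ?normr_gt0// pmulrn_lgt0.
have [eE r0] := gt0_real_complex q0.
set r := complex.Re _ in eE r0.
have [m [[Mm Nm] lm]] : exists m, near_min (r ^+ 2) m /\ ball l r%:C m.
  apply: (@filter_ex _ _ FF); apply: filterI; first by exists (r ^+ 2); rewrite //= exprn_gt0.
  by apply: Fl; apply: nbhsx_ballx; rewrite ltcR.
have b1 : `|dotH (x - m) b| ^+ 2 <= r%:C ^+ 2 * c.
  apply: (le_trans (@sqr_dotH_le_gap d%:C _ _ _)) => [t|].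
    rewrite -addrA -opprD; apply: dmin; rewrite addrC; exact: MZD.
  rewrite ler_wpM2r// ?(ltW c0)// -NE -rmorphXn -rmorphB lecR.
  by move: Nm; lra.
have b2 : `|dotH (m - l) b| ^+ 2 <= r%:C ^+ 2 * c.
  apply: (le_trans (sqr_dotH_le _ _)); rewrite ler_wpM2r ?(ltW c0)//.
  rewrite -dotH_norm ler_sqr ?nnegrE// ?ler0c ?(ltW r0)//.
  by move: lm; rewrite -ball_normE /= distrC => /ltW.
have : `|a| ^+ 2 <= r%:C ^+ 2 * c *+ 4.
  have -> : a = dotH (x - m) b + dotH (m - l) b by rewrite -linearDl/= addrA subrK.
  apply: (le_trans (sqr_normD _ _)).
  by rewrite (_ : 4 = 2 * 2)%N// mulrnA lerMn2r/= [leRHS]mulr2n lerD.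
rewrite eE.
have -> : (`|a| / (c *+ 4)) ^+ 2 * c *+ 4 = `|a| ^+ 2 / (c *+ 4).
  by field; rewrite gt_eqF.
rewrite ler_pdivlMr ?pmulrn_lgt0// -[leRHS]mulr1 ler_pM2l ?exprn_gt0 ?normr_gt0//.
have c4 : 1 < c *+ 4 by rewrite (@lt_le_trans _ _ 4) ?ltr1n// lerMn2r.
by rewrite lt_geF.
Qed.
End Projection.

Lemma linear_span0 B : linear_span B 0.
Proof.
exists 0%N, (fun=> 0), (fun=> 0); split; first by case.
by rewrite big_ord0.
Qed.

Lemma linear_spanZD B (k : R[i]) x y :
  linear_span B x -> linear_span B y -> linear_span B (k *: x + y).
Proof.
move=> [n [c [b [bB ->]]]] [n' [c' [b' [b'B ->]]]].
exists (n + n')%N,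
  (fun i => match fintype.split i with inl j => k * c j | inr j => c' j end),
  (fun i => match fintype.split i with inl j => b j | inr j => b' j end).
split; first by move=> i; case: (fintype.split i).
rewrite big_split_ord/= scaler_sumr; congr (_ + _); apply: eq_bigr => i _.
  by rewrite (unsplitK (inl i)) scalerA.
by rewrite (unsplitK (inr i)).
Qed.

Lemma linear_span_sub B : B `<=` linear_span B.
Proof.
by move=> x Bx; exists 1%N, (fun=> 1), (fun=> x); rewrite big_ord1 scale1r.
Qed.

Lemma linear_span_min B V : V 0 ->
  (forall (k : R[i]) x y, V x -> V y -> V (k *: x + y)) ->
  B `<=` V -> linear_span B `<=` V.
Proof.
move=> V0 VZD BV x [n [c [b [bB ->]]]].
apply: big_ind => // [u v Vu Vv|i _]; first by rewrite -[u]scale1r; exact: VZD.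
by rewrite -[_ *: _]addr0; apply: VZD => //; exact: BV.
Qed.

(** The difference between a vector of [V] and its projection on the closed span
    of [B] stays in [V] and is orthogonal to [B]. *)
Lemma dense_span B V : closed V -> V 0 ->
  (forall (k : R[i]) x y, V x -> V y -> V (k *: x + y)) -> B `<=` V ->
  (forall x, V x -> (forall b, B b -> dotH x b = 0) -> x = 0) ->
  V `<=` closure (linear_span B).
Proof.
move=> cV V0 VZD BV orth0 x Vx.
have [l Ml xl] := @projection _ (linear_span0 B) (@linear_spanZD B) x.
have Vl : V l.
  move/closure_id: cV => ->; apply: closureS Ml; exact: linear_span_min.
suff : x - l = 0 by move/subr0_eq ->.
apply: orth0; first by rewrite addrC -scaleN1r; exact: VZD.
by move=> b Bb; apply: xl; exact: linear_span_sub.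
Qed.

Lemma dotH_eq0C x y : dotH x y = 0 -> dotH y x = 0.
Proof. by move=> xy; rewrite hermC/= xy rmorph0 mulr0. Qed.

(** By Zorn: normalising a nonzero vector orthogonal to a maximal orthonormal
    subset would enlarge it. *)
Lemma exists_maximal_orthonormal V : (forall (k : R[i]) x, V x -> V (k *: x)) ->
  exists B, [/\ B `<=` V, orthonormal_set B &
    forall x, V x -> (forall b, B b -> dotH x b = 0) -> x = 0].
Proof.
move=> VZ.
have [|B [[BV [B1 Borth]] Bmax]] := @Zorn_bigcup H
    [set B | B `<=` V /\ orthonormal_set B].
  move=> F FP Ftot; split; first by move=> x [X /FP[+ _]]; apply.
  split=> [x [X /FP[_ [+ _]]]|x y [X FX Xx] [Y FY Yy]]; first by apply.
  by have [XY|YX] := Ftot _ _ FX FY;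
    [have [_ [_]] := FP _ FY|have [_ [_]] := FP _ FX]; apply => //;
    [exact: XY|exact: YX].
exists B; split=> // x Vx xB; apply/eqP/negP => /negP x0.
pose y := `|x|^-1 *: x.
have yy : dotH y y = 1.
  by rewrite dnormZ -dotH_norm normfV normr_id -exprMn mulVf ?normr_eq0// expr1n.
have yB b : B b -> dotH y b = 0.
  by move=> Bb; rewrite linearZl_LR/= xB// mulr0.
apply: (Bmax (B `|` [set y])).
  split; first by move=> b; left.
  move=> /(_ y (or_intror erefl))/yB/eqP; rewrite yy; exact/negP/oner_neq0.
split; first by move=> _ [/BV//|->]; exact: VZ.
split; first by move=> _ [/B1//|->].
move=> a b [Ba|->] [Bb|->] => //; [exact: Borth|move=> _|move=> _].
- exact/dotH_eq0C/yB.
- exact: yB.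
Qed.

End Hilbert.

(** * Representations on a Hilbert space *)

Section Representation.
Context {R : realType} {A : cstarAlgType R} {H : hilbertType R}.
Variable phi : representation A H.
Implicit Types (a b : A) (x y : H).

Lemma repD a b x : phi (a + b) x = phi a x + phi b x.
Proof. by rewrite -[a]scale1r rep_linear !scale1r. Qed.

Lemma rep0 x : phi 0 x = 0.
Proof. by apply: (addrI (phi 0 x)); rewrite -repD !addr0. Qed.

Lemma dotH_star a x y : dotH (phi (cstar a) x) y = dotH x (phi a y).
Proof. by rewrite rep_star cstarK. Qed.

(** Both sides are adjoints of [phi a], and the inner product determines the
    adjoint; this settles that [adjoint] does not take its default value. *)
Lemma adjoint_rep a : adjoint (phi a) = phi (cstar a).
Proof.
have adj : is_adjoint (phi a) (adjoint (phi a)).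
  by apply: (xgetPex (fun=> 0)); exists (phi (cstar a) : H -> H); exact: rep_star.
apply/funext => y; apply/subr0_eq/eqP; rewrite -(dnorm_eq0 dotH) linearB/=.
by rewrite -adj -rep_star subrr.
Qed.

Lemma range_idempotent a x : cmul a a = a -> range (phi a) x <-> phi a x = x.
Proof.
by move=> aa; split=> [[y _ <-]|ax]; [rewrite -repM aa|exists x].
Qed.

Lemma total_orthonormal_range a (B : set H) : cmul a a = a ->
  (forall b : H, B b -> phi a b = b) -> orthonormal_set B ->
  (forall x, phi a x = x -> (forall b : H, B b -> dotH x b = 0) -> x = 0) ->
  total_orthonormal_set (range (phi a)) B.
Proof.
move=> aa Ba Bon orth0.
have -> : range (phi a) = [set x | phi a x = x].
  by apply/seteqP; split=> x /(range_idempotent _ aa).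
split=> //; apply: dense_span => //.
- have -> : [set x | phi a x = x] = (fun x => phi a x - x) @^-1` [set 0].
    by apply/seteqP; split=> x /= => [->|/subr0_eq//]; rewrite subrr.
  apply: preimage_closed => [x _|].
    by apply: continuousB; [exact: bounded_operator_continuous|exact: cvg_id].
  exact/accessible_closed_set1/hausdorff_accessible/norm_hausdorff.
- exact: linear0.
- by move=> k x y /= ax ay; rewrite linearP ax ay.
Qed.
End Representation.

(** * The bases attached to vertices and edges *)

Section Basis.
Context {R : realType} {E : graph} {A : cstarAlgType R}.
Variables (P : vertex E -> A) (S : edge E -> A).
Hypothesis fam : graph_family P S.
Context {H : hilbertType R}.
Variable phi : representation A H.
Implicit Types (v : vertex E) (e f : edge E) (x y : H).

Local Notation p v := (phi (P v)).
Local Notation s e := (phi (S e)).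
Local Notation s' e := (phi (cstar (S e))).

Lemma init_final e x : s' e (s e x) = p (range_of e) x.
Proof. by rewrite -repM (family_init fam). Qed.

Lemma pisom e x : s e (s' e (s e x)) = s e x.
Proof. by rewrite -!repM -cmulA (cmulA (S e)) (family_pisom fam). Qed.

Lemma pisom_star e x : s' e (s e (s' e x)) = s' e x.
Proof.
rewrite -!repM; congr (phi _ _).
by rewrite -[in RHS](family_pisom fam) !cstarM cstarK !cmulA.
Qed.

Lemma proj_isom e x : p (source_of e) (s e x) = s e x.
Proof.
by rewrite -[in LHS]pisom -[phi (S e) (phi (cstar _) _)]repM -[LHS]repM
  (family_final fam) repM pisom.
Qed.

Lemma proj_isom_star e x : p (range_of e) (s' e x) = s' e x.
Proof. by rewrite -init_final pisom_star. Qed.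

Lemma range_orth e f x : e <> f -> s' e (s f x) = 0.
Proof.
move=> ef; rewrite -pisom_star -[s f x]pisom.
rewrite -[phi (S e) (phi _ _)]repM -[phi (S f) (phi _ _)]repM -[phi (cmul (S e) _) _]repM.
by rewrite (family_range_orth fam ef) rep0 linear0.
Qed.

Lemma dotH_isom e x y : p (range_of e) x = x -> dotH (s e y) (s e x) = dotH y x.
Proof. by move=> px; rewrite (rep_star phi) init_final px. Qed.

(** The orthogonal complement in [H_v] of the subspaces [H_e], [e] leaving [v],
    since [phi (S e)^* x] vanishes exactly when [x] is orthogonal to [H_e]. *)
Definition defect_space v : set H :=
  [set x | p v x = x /\ forall e, source_of e = v -> s' e x = 0].

Lemma defect_space_eq0 v x : outgoing v !=set0 -> finite_set (outgoing v) ->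
  defect_space v x -> x = 0.
Proof.
move=> ne fin [px s'x]; rewrite -px (family_sum fam ne fin) fsbig_finite//=.
rewrite (@big_morph _ _ (fun a => phi a x) 0 +%R) ?rep0//; last by move=> a b; exact: repD.
rewrite big_seq big1// => e; rewrite in_fset_set// inE => /s'x sx.
by rewrite repM sx linear0.
Qed.

Section InductiveBasis.
Variable D : vertex E -> set H.
Hypothesis D_sub : forall v, D v `<=` defect_space v.
Hypothesis D_orthonormal : forall v, orthonormal_set (D v).
Hypothesis D_total : forall v x, defect_space v x ->
  (forall b, D v b -> dotH x b = 0) -> x = 0.

(** Inductive rather than recursive on vertices, so that it makes sense in any
    graph; along infinite forward paths it only yields the vectors reached in
    finitely many steps. *)
Inductive basis v : set H :=
| basis_defect x of D v x : basis v x
| basis_shift e x of source_of e = v & basis (range_of e) x : basis v (s e x).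

Lemma basis_proj v x : basis v x -> p v x = x.
Proof.
by case=> [{}x /D_sub[]//|e {}x <- _]; exact: proj_isom.
Qed.

Lemma basis_norm v x : basis v x -> dotH x x = 1.
Proof.
elim=> {v x} [v x Dx|e v x _ bx <-]; first exact: (D_orthonormal v).1.
by rewrite dotH_isom// basis_proj.
Qed.

Lemma basis_orth v x y : basis v x -> basis v y -> x <> y -> dotH x y = 0.
Proof.
move=> bx; elim: bx y => {v x} [v x Dx|v e x <- bx IH] y.
  case=> [{}y Dy|e {}y sv _ _]; first exact: (D_orthonormal v).2.
  by rewrite -dotH_star (D_sub Dx).2// linear0l.
case=> [{}y Dy _|f {}y _ bey].
  by rewrite rep_star (D_sub Dy).2// linear0r.
have [fe|ef _] := pselect (e = f); last by rewrite rep_star range_orth// linear0r.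
move: bey; rewrite -fe => bey.
rewrite dotH_isom; last exact: basis_proj.
by move=> xy; apply: IH => // xyE; apply: xy; rewrite xyE.
Qed.

Lemma basis_orthonormal v : orthonormal_set (basis v).
Proof. by split=> [x|x y]; [exact: basis_norm|exact: basis_orth]. Qed.

(** The adjoints [phi (S e)^*] push a vector orthogonal to [basis v] one step
    along each edge leaving [v]; well-foundedness stops the descent. *)
Lemma basis_total v x : Acc (@successor E) v ->
  p v x = x -> (forall b, basis v b -> dotH x b = 0) -> x = 0.
Proof.
move=> acc; elim: acc x => {}v _ IH x px xb.
apply: (@D_total v) => [|b Db]; last by apply: xb; left.
split=> // e sv; apply: (IH (range_of e)); first by exists e.
  exact: proj_isom_star.
by move=> b bb; rewrite dotH_star; apply: xb; right.
Qed.

End InductiveBasis.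
End Basis.

(** * Existence of compatible bases *)

Theorem theorem3p5 (R : realType) (E : graph)
  (A : cstarAlgType R) (P : vertex E -> A) (S : edge E -> A)
  (CstarE : is_graph_algebra P S)
  (E_simple : P_simple E)
  (Z_connected : connected_in (@non_isolated E))
  (fin_layer : exists (n : nat) (G : subgraph E),
     [/\ (1 <= n)%N, layer n G & finite_set (sub_vertex G)])
  (H : hilbertType R) (phi : representation A H) :
  exists (Bv : vertex E -> set H) (Be : edge E -> set H),
    [/\ forall v, total_orthonormal_set (range (phi (P v))) (Bv v),
        forall e, total_orthonormal_set
                    (range (phi (S e) \o adjoint (phi (S e)))) (Be e),
        forall v,
          (forall e, e \in outgoing v -> Be e `<=` Bv v) /\
          (outgoing v !=set0 -> finite_set (outgoing v) ->
             Bv v = \bigcup_(e in outgoing v) Be e) &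
        forall v e, e \in incoming v -> phi (S e) @` Bv v = Be e].
Proof.
have [n [G [_ lay finG]]] := fin_layer.
have wf := successor_wf E_simple lay finG.
have fam := graph_algebra_family CstarE.
have /choice[D DP] v : exists Dv : set H,
    [/\ Dv `<=` defect_space P S phi v, orthonormal_set Dv &
      forall x, defect_space P S phi v x ->
        (forall b, Dv b -> dotH x b = 0) -> x = 0].
  apply: exists_maximal_orthonormal => k x [px sx].
  by split=> [|e sv]; rewrite linearZ/= ?px// sx// scaler0.
have Dsub v : D v `<=` defect_space P S phi v by case: (DP v).
have Don v : orthonormal_set (D v) by case: (DP v).
have Dtot v := let: And3 _ _ h := DP v in h.
pose B := basis S phi D.
have Bproj v x : B v x -> phi (P v) x = x by exact: basis_proj.
have Bon v : orthonormal_set (B v) by exact: (basis_orthonormal fam Dsub Don).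
have Btot v x : phi (P v) x = x -> (forall b, B v b -> dotH x b = 0) -> x = 0.
  by apply: (basis_total fam Dtot) (wf v).
exists B, (fun e => phi (S e) @` B (range_of e)); split.
- move=> v; apply: total_orthonormal_range.
  + by have [] := family_proj fam v.
  + exact: Bproj.
  + exact: Bon.
  + exact: Btot.
- move=> e; rewrite adjoint_rep.
  have -> : phi (S e) \o phi (cstar (S e)) = phi (cmul (S e) (cstar (S e))).
    by apply/funext => x; rewrite /= repM.
  have sdot b c : B (range_of e) b -> dotH (phi (S e) c) (phi (S e) b) = dotH c b.
    by move=> /Bproj; exact: dotH_isom.
  apply: total_orthonormal_range.
  + by rewrite cmulA (family_pisom fam).
  + by move=> _ [b _ <-]; rewrite repM (pisom fam).
  + split=> [_ [b Bb <-]|_ _ [b Bb <-] [c Bc <-] bc].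
      by rewrite sdot//; exact: (Bon (range_of e)).1.
    by rewrite sdot//; apply: (Bon (range_of e)).2 => // bcE; apply: bc; rewrite bcE.
  + move=> x; rewrite repM => sx xb; rewrite -sx.
    suff -> : phi (cstar (S e)) x = 0 by rewrite linear0.
    apply: (Btot (range_of e)); first exact: (proj_isom_star fam).
    by move=> b Bb; rewrite dotH_star; apply: xb; exists b.
- move=> v; split.
    by move=> e; rewrite inE => sv _ [x Bx <-]; right.
  move=> ne fin; apply/seteqP; split=> x.
    case=> [{}x Dx|e {}x sv Bx]; last by exists e => //; exists x.
    have := (Don v).1 x Dx; rewrite (defect_space_eq0 fam ne fin (Dsub v x Dx)) linear0l.
    by move=> /esym/eqP; rewrite oner_eq0.
  by move=> [e sv [y By <-]]; right.
- by move=> v e; rewrite inE => <-.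
Qed.
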